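(* Let $\gamma:\mathbb{R}\to\mathbb{R}^4$ be a closed (periodic) Lagrangian curve parameterized by the symplectic arc-length $s$, with constant symplectic curvatures $\kappa_3,\kappa_4$ and symplectic length (minimal period) $\ell_\gamma$ (so that $\kappa_3>0$ and $\kappa_3^2-\kappa_4>0$), and let $(E_1,E_2,E_3,E_4):\mathbb{R}\to\mathrm{Sp}(4,\mathbb{R})$ be the symplectic Frenet frame along $\gamma$. Let $h\in\mathbb{R}$ and let $\alpha=(x,y,z):\mathbb{R}\to\mathbb{R}^3$, $\vartheta\mapsto\alpha(\vartheta)$, be a smooth closed regular curve of length $\ell_\alpha$ parameterized by Euclidean arc-length, whose trajectory lies either in $\{x^2+\kappa_3y^2-z^2=h,\ z>0\}$ or in $\{x^2+\kappa_3y^2-z^2=h,\ z<0\}$. Define $$f(s,\vartheta)=\gamma(s)+x(\vartheta)E_2(s)+\frac{1}{\kappa_3^2-\kappa_4}\left(\sqrt{\kappa_3^2-\kappa_4}\,z(\vartheta)-1\right)E_3(s)+y(\vartheta)E_4(s).$$ Then $f:\mathbb{R}^2\to\mathbb{R}^4$ is doubly periodic with lattice of periods $L_{(\gamma,\alpha)}$ generated by $(\ell_\gamma,0)$ and $(0,\ell_\alpha)$, and both $f$ and the induced map $\tilde f:\mathbb{R}^2/L_{(\gamma,\alpha)}\to\mathbb{R}^4$ are Lagrangian immersions.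
   Context: On $\mathbb{R}^4$ let $\Lambda(X,Y)=x_1y_3+x_2y_4-x_3y_1-x_4y_2$; $\mathrm{Sp}(4,\mathbb{R})$ is the group of linear maps preserving $\Lambda$, identified with bases satisfying $\Lambda(E_1,E_3)=\Lambda(E_2,E_4)=1$ and all other $\Lambda(E_a,E_b)=0$ for $a<b$. A smooth curve $\gamma$ is Lagrangian if $\gamma',\gamma''$ are linearly independent and $\Lambda(\gamma',\gamma'')=0$. It is parameterized by the symplectic arc-length if $\Lambda(\gamma'',\gamma''')\equiv 1$. In that parametrization, $\kappa_3=\Lambda(\gamma''',\gamma^{(4)})$ and $\kappa_4=\Lambda(\gamma^{(4)},\gamma^{(5)})$. The symplectic Frenet frame is $E_1=\gamma'$, $E_2=\gamma''$, $E_4=\gamma'''$, $E_3=-\gamma^{(4)}-\kappa_3\gamma''$; it satisfies $\gamma'=E_1$, $E_1'=E_2$, $E_2'=E_4$, $E_3'=(\kappa_3^2-\kappa_4)E_1$, $E_4'=-\kappa_3E_2-E_3$. An immersion $f$ of a surface into $\mathbb{R}^4$ is Lagrangian if $\Lambda$ vanishes on all its tangent planes. *)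

(* Defs.v *)
From HB Require Import structures.
From mathcomp Require Import all_boot all_order all_algebra.
From mathcomp Require Import all_classical all_reals all_analysis.
Set Implicit Arguments.
Unset Strict Implicit.
Unset Printing Implicit Defensive.
Import Order.TTheory GRing.Theory Num.Theory.
Import numFieldNormedType.Exports.

Local Open Scope ring_scope.
Local Open Scope classical_set_scope.
Local Open Scope quotient_scope.

(* The coordinates x_1, ..., x_4 of R^4 are X 0 0, ..., X 0 3. *)
Definition Lambda (R : realType) (X Y : 'rV[R]_4) : R :=
  X 0 0 * Y 0 2 + X 0 1 * Y 0 3 - X 0 2 * Y 0 0 - X 0 3 * Y 0 1.

Definition smooth_curve (R : realType) (V : normedModType R) (c : R -> V) : Prop :=
  forall (n : nat) (t : R), derivable (derive1n n c) t 1.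

Fixpoint Ck_on (R : realType) (V W : normedModType R) (k : nat) (U : set V)
    (f : V -> W) : Prop :=
  if k is k'.+1 then
    (forall p, U p -> differentiable f p) /\ forall v, Ck_on k' U ('D_v f)
  else forall p, U p -> {for p, continuous f}.

(* C^oo, for U open. *)
Definition smooth_on (R : realType) (V W : normedModType R) (U : set V)
    (f : V -> W) : Prop :=
  forall k, Ck_on k U f.

Definition lagrangian_curve (R : realType) (g : R -> 'rV[R]_4) : Prop :=
  smooth_curve g /\
  forall s, free [:: derive1n 1 g s; derive1n 2 g s] /\
            Lambda (derive1n 1 g s) (derive1n 2 g s) = 0.

Definition symplectic_arclength (R : realType) (g : R -> 'rV[R]_4) : Prop :=
  forall s, Lambda (derive1n 2 g s) (derive1n 3 g s) = 1.

Definition kappa3 (R : realType) (g : R -> 'rV[R]_4) (s : R) : R :=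
  Lambda (derive1n 3 g s) (derive1n 4 g s).

Definition kappa4 (R : realType) (g : R -> 'rV[R]_4) (s : R) : R :=
  Lambda (derive1n 4 g s) (derive1n 5 g s).

Definition frenet1 (R : realType) (g : R -> 'rV[R]_4) (s : R) : 'rV[R]_4 :=
  derive1n 1 g s.
Definition frenet2 (R : realType) (g : R -> 'rV[R]_4) (s : R) : 'rV[R]_4 :=
  derive1n 2 g s.
Definition frenet3 (R : realType) (g : R -> 'rV[R]_4) (s : R) : 'rV[R]_4 :=
  - derive1n 4 g s - kappa3 g s *: derive1n 2 g s.
Definition frenet4 (R : realType) (g : R -> 'rV[R]_4) (s : R) : 'rV[R]_4 :=
  derive1n 3 g s.

Definition minimal_period (R : realType) (T : Type) (c : R -> T) (l : R) : Prop :=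
  [/\ 0 < l, forall t, c (t + l) = c t &
      forall l', 0 < l' -> (forall t, c (t + l') = c t) -> l <= l'].

(* The norm of 'rV[R]_n provided by the library is the sup norm. *)
Definition euclidean_norm (R : realType) (n : nat) (v : 'rV[R]_n) : R :=
  Num.sqrt (\sum_i v 0 i ^+ 2).

Definition unit_speed (R : realType) (n : nat) (c : R -> 'rV[R]_n) : Prop :=
  forall t, euclidean_norm (derive1 c t) = 1.

(* For a unit-speed closed curve the length, i.e. the integral of |c'| over one
   minimal period, is the minimal period itself. *)
Definition closed_arclength_curve (R : realType) (n : nat) (c : R -> 'rV[R]_n)
    (l : R) : Prop :=
  [/\ smooth_curve c, unit_speed c & minimal_period c l].

Section Lattice.
Variables (R : realType) (v w : R * R).

Definition lattice : {pred R * R} :=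
  fun p => `[< exists m n : int, p = v *~ m + w *~ n >].

Lemma lattice_zmod_closed : zmod_closed lattice.
Proof.
split=> [|p q].
  by apply/asboolP; exists 0, 0; rewrite !mulr0z addr0.
move=> /asboolP[m [n ->]] /asboolP[m' [n' ->]]; apply/asboolP.
by exists (m - m'), (n - n'); rewrite !mulrzBr opprD addrACA.
Qed.

HB.instance Definition _ :=
  GRing.isZmodClosed.Build (R * R)%type lattice lattice_zmod_closed.

End Lattice.

(* The underlying set of the torus R^2 / <v, w>; \pi_(torus v w) is the
   projection of R^2 onto it. *)
Definition torus (R : realType) (v w : R * R) := Quotient.quot (lattice v w).
HB.instance Definition _ (R : realType) (v w : R * R) :=
  EqQuotient.on (torus v w).

Definition lagrangian_immersion_on (R : realType) (U : set (R * R))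
    (f : R * R -> 'rV[R]_4) : Prop :=
  [/\ smooth_on U f,
      forall p, U p -> injective ('d f p) &
      forall p, U p -> forall u v, Lambda ('d f p u) ('d f p v) = 0].

(* The smooth structure of R^2 / <v, w> has as charts the inverses of the
   restrictions of \pi to the open sets U of R^2 on which \pi is injective; the
   expression of g in such a chart is g \o \pi on U.  Every point is required to
   lie in the domain of a chart in which g is a Lagrangian immersion. *)
Definition torus_lagrangian_immersion (R : realType) (v w : R * R)
    (g : torus v w -> 'rV[R]_4) : Prop :=
  forall q : torus v w, exists U : set (R * R),
    [/\ open U,
        {in U &, injective \pi_(torus v w)},
        exists2 p, U p & \pi_(torus v w) p = q &
        lagrangian_immersion_on U (fun p => g (\pi_(torus v w) p))].

(* a = (x, y, z), and k3, k4 stand for the constant values of kappa3 g, kappa4 g. *)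
Definition curve_pair_map (R : realType) (k3 k4 : R) (g : R -> 'rV[R]_4)
    (a : R -> 'rV[R]_3) (p : R * R) : 'rV[R]_4 :=
  let: (s, t) := p in
  g s + a t 0 0 *: frenet2 g s
  + ((k3 ^+ 2 - k4)^-1 * (Num.sqrt (k3 ^+ 2 - k4) * a t 0 2 - 1)) *: frenet3 g s
  + a t 0 1 *: frenet4 g s.

(* Main.v *)
Require Import Defs.
From HB Require Import structures.
From mathcomp Require Import all_boot all_order all_algebra.
From mathcomp Require Import all_classical all_reals all_analysis.
From mathcomp Require Import ring lra.
Set Implicit Arguments.
Unset Strict Implicit.
Unset Printing Implicit Defensive.
Import Order.TTheory GRing.Theory Num.Theory.
Import numFieldNormedType.Exports.

Local Open Scope ring_scope.
Local Open Scope classical_set_scope.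
Local Open Scope quotient_scope.

(** Write [c = k3^2 - k4].  The Gram matrix of the first five derivatives of
    [gamma] with respect to [Lambda] is forced by the normalisations, so
    [gamma] solves the linear equation with characteristic polynomial
    [X^4 + k3 X^2 + c] for its velocity ([frenet_ode]).

    Positivity.  A periodic curve excludes characteristic roots off the
    imaginary axis: a real linear or quadratic factor of the polynomial gives
    an explicit combination [W] of the derivatives that satisfies [W' = mu W] or a
    second-order equation with negative damping, and a monotone quantity built
    from [W] shows that a periodic [W] vanishes, against the independence of
    the frame; the root 0 is excluded because no closed curve has a constant
    nonzero velocity ([closed_curve_discriminant_gt0], [closed_curve_curvature_gt0]).

    Immersion.  In the Frenet basis the two partial derivatives of [f] have
    coordinates [(sqrt c z, - k3 y, - y, x)] and [(0, x', z' / sqrt c, y')].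
    They are independent because [z] does not vanish and [alpha] is regular, and
    [Lambda] of the pair is minus half the derivative of [x^2 + k3 y^2 - z^2],
    that is, zero ([lagrangian_immersion_frenet_sum]).

    Periods.  Since [E3' = c gamma'], the curve is [gamma = E3 / c + v], hence
    [f - v = x E2 + (z / sqrt c) E3 + y E4].  Suppose that [(a, b)] is a
    period.  The curve [alpha] lies in no plane through the origin, as a closed
    curve on the quadric avoiding [z = 0] would otherwise have a critical point
    ([quadric_curve_spans]).  Pairing the relation between the frames at [s] and
    [s + a] with [E3 s], and differentiating in [s], gives [E3 s = p E3 (s + a)]
    with [p^2 = 1]; the constant sign of [z] excludes [p = -1]
    ([frenet_shift_rigid]).  So [a] is a period of [gamma], then [b] is one of
    [alpha], and minimality of the two periods puts [(a, b)] in the lattice.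

    The map on the torus is [f] composed with a section of the projection, and
    a ball whose radius is half the smaller period is a chart domain
    ([torus_lagrangian_immersion_quotient]). *)

(** * Calculus of curves *)

Section OneVariable.
Context {R : realType}.

Lemma is_derive_coord (n : nat) (X : R -> 'rV[R]_n) (t : R) (dX : 'rV[R]_n) i :
  is_derive t 1 X dX -> is_derive t 1 (fun s => X s 0 i) (dX 0 i).
Proof.
case=> dX1 <-; apply: DeriveDef; first exact: (derivable_mxP _ _ _).1.
by rewrite derive_mx // mxE.
Qed.

Lemma is_derive_translate (V : normedModType R) (G : R -> V) (a t : R) (dG : V) :
  is_derive (t + a) 1 G dG -> is_derive t 1 (fun s => G (s + a)) dG.
Proof.
have E : (fun h : R => h^-1 *: (G (h *: 1 + t + a) - G (t + a))) =
         (fun h : R => h^-1 *: (G (h *: 1 + (t + a)) - G (t + a))).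
  by apply/funext => h; rewrite addrA.
case=> dG1 <-; apply: DeriveDef.
  by move: dG1; rewrite /derivable /= E.
by rewrite /derive /= E.
Qed.

Lemma is_derive_unique (V : normedModType R) (G : R -> V) (t : R) (d d' : V) :
  is_derive t 1 G d -> is_derive t 1 G d' -> d = d'.
Proof. by case=> _ <- [_ <-]. Qed.

Lemma derive_periodic (V : normedModType R) (X dX : R -> V) (a : R) :
  (forall s : R, is_derive s 1 X (dX s)) -> (forall s, X (s + a) = X s) ->
  forall s, dX (s + a) = dX s.
Proof.
move=> hX pX s; have := is_derive_translate (hX (s + a)).
rewrite (_ : (fun u => X (u + a)) = X); last by apply/funext.
by move=> h; exact: is_derive_unique h (hX s).
Qed.

Lemma is_derive_row_const (n : nat) (X : R -> 'rV[R]_n) :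
  (forall t : R, is_derive t 1 X 0) -> forall s t, X s = X t.
Proof.
move=> dX s t; apply/rowP => i.
apply: (@is_derive_0_is_cst _ (fun u => X u 0 i)) => u.
by have := is_derive_coord i (dX u); rewrite mxE.
Qed.

Lemma is_derive_Lambda (X Y : R -> 'rV[R]_4) (t : R) (dX dY : 'rV[R]_4) :
  is_derive t 1 X dX -> is_derive t 1 Y dY ->
  is_derive t 1 (fun s => Lambda (X s) (Y s))
    (Lambda dX (Y t) + Lambda (X t) dY).
Proof.
move=> hX hY; have cX i := is_derive_coord i hX; have cY i := is_derive_coord i hY.
rewrite /Lambda; apply: is_derive_eq => /=.
by rewrite !/GRing.scale /=; ring.
Qed.

Lemma smooth_is_derive (V : normedModType R) (c : R -> V) (n : nat) (t : R) :
  smooth_curve c -> is_derive t 1 c^`(n) (c^`(n.+1) t).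
Proof. by move=> /(_ n t) dc; rewrite derive1nS derive1E; apply: DeriveDef. Qed.

Lemma smooth_is_derive0 (V : normedModType R) (c : R -> V) (t : R) :
  smooth_curve c -> is_derive t 1 c (c^`() t).
Proof. exact: (@smooth_is_derive _ _ 0). Qed.

Lemma smooth_curve_derive1 (V : normedModType R) (c : R -> V) :
  smooth_curve c -> smooth_curve c^`().
Proof. by move=> sc n t; have := sc n.+1 t; rewrite derive1Sn. Qed.

Lemma smooth_curve_derive1n (V : normedModType R) (c : R -> V) n :
  smooth_curve c -> smooth_curve c^`(n).
Proof. by move=> sc; elim: n => // n IH; rewrite derive1nS; apply: smooth_curve_derive1. Qed.

Lemma is_derive_derive1 (V : normedModType R) (c dc : R -> V) :
  (forall t : R, is_derive t 1 c (dc t)) -> c^`() = dc.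
Proof. by move=> h; apply/funext => t; rewrite derive1E; case: (h t). Qed.

Lemma smooth_curve_cst (V : normedModType R) (v : V) :
  smooth_curve (fun=> v : V).
Proof.
move=> n t; suff [w ->] : exists w : V, derive1n n (fun=> v) = (fun=> w) :> (R -> V).
  exact: derivable_cst.
elim: n => [|n [w IH]]; first by exists v.
by exists 0; rewrite derive1nS IH; apply/funext => u; rewrite derive1_cst.
Qed.

Lemma smooth_curveD (V : normedModType R) (c d : R -> V) :
  smooth_curve c -> smooth_curve d -> smooth_curve (fun t => c t + d t).
Proof.
move=> sc sd n t.
suff -> : derive1n n (fun t => c t + d t) = (fun t => derive1n n c t + derive1n n d t).
  by apply: derivableD; [exact: sc|exact: sd].
elim: n => // n IH; rewrite derive1nS IH; apply: is_derive_derive1 => u.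
by apply: is_deriveD; exact: smooth_is_derive.
Qed.

Lemma smooth_curveZ (V : normedModType R) (k : R) (c : R -> V) :
  smooth_curve c -> smooth_curve (fun t => k *: c t).
Proof.
move=> sc n t.
suff -> : derive1n n (fun t => k *: c t) = (fun t => k *: derive1n n c t).
  by apply: derivableZ; exact: sc.
elim: n => // n IH; rewrite derive1nS IH; apply: is_derive_derive1 => u.
by apply: is_deriveZ; exact: smooth_is_derive.
Qed.

Lemma smooth_curve_coord (n : nat) (c : R -> 'rV[R]_n) i :
  smooth_curve c -> smooth_curve (fun t => c t 0 i).
Proof.
move=> sc m t.
suff -> : derive1n m (fun t => c t 0 i) = (fun t => derive1n m c t 0 i).
  by have [] := is_derive_coord i (smooth_is_derive m t sc).
elim: m => // m IH; rewrite derive1nS IH; apply: is_derive_derive1 => u.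
by apply: is_derive_coord; exact: smooth_is_derive.
Qed.

End OneVariable.

Section Periodic.
Context {R : realType}.

Lemma periodic_derive1n (V : normedModType R) (c : R -> V) (l : R) :
  (forall t, c (t + l) = c t) -> forall n t, c^`(n) (t + l) = c^`(n) t.
Proof.
move=> pc; elim=> // n IH t; rewrite !derive1nS /derive1.
have limE (u v : R -> V) : u = v -> lim (u @ 0^') = lim (v @ 0^') by move=> ->.
by apply: limE; apply/funext => h; rewrite addrA !IH.
Qed.

Lemma periodic_mulrz (T : Type) (c : R -> T) (l : R) (m : int) :
  (forall t, c (t + l) = c t) -> forall t, c (t + l *~ m) = c t.
Proof.
move=> pc.
have pn (n : nat) : forall t, c (t + l *+ n) = c t.
  by elim: n => [t|n IH t]; rewrite ?mulr0n ?addr0 // mulrSr addrA pc.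
case: m => n t; first exact: pn.
by rewrite NegzE mulrNz -pmulrn -[LHS](pn n.+1) subrK.
Qed.

(** The remainder of [a] modulo [l] is a nonnegative period smaller than [l], hence zero. *)
Lemma minimal_period_multiple (T : Type) (c : R -> T) (l a : R) :
  minimal_period c l -> (forall t, c (t + a) = c t) ->
  exists m : int, a = l *~ m.
Proof.
move=> [l0 pl minl] pa; pose m := Num.floor (a / l); exists m.
pose r := a - l *~ m.
have pr t : c (t + r) = c t.
  by rewrite /r -mulrNz addrA periodic_mulrz.
have r0 : 0 <= r.
  rewrite subr_ge0 -mulrzr mulrC -ler_pdivlMr //.
  exact: Num.Theory.floor_le.
have rl : r < l.
  have : a / l < (m + 1)%:~R by exact: floorD1_gt.
  by rewrite ltr_pdivrMr // intrD mulrDl mul1r mulrC mulrzr /r; lra.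
apply/eqP; rewrite -subr_eq0 -/r; apply/negPn/negP => rn0.
have := minl r; rewrite lt0r rn0 r0 => /(_ isT pr); rewrite leNgt.
by rewrite rl.
Qed.

Lemma derivable_line_continuous (f df : R -> R) :
  (forall t : R, is_derive t 1 f (df t)) -> continuous f.
Proof.
move=> hf t; apply/differentiable_continuous/derivable1_diffP.
by case: (hf t).
Qed.

(** A nondecreasing periodic function is constant: any value is attained again
    arbitrarily far to the right. *)
Lemma periodic_monotone_const (f df : R -> R) (l : R) :
  0 < l -> (forall t, f (t + l) = f t) ->
  (forall t : R, is_derive t 1 f (df t)) -> (forall t, 0 <= df t) ->
  forall t, df t = 0.
Proof.
move=> l0 pf hf df0.
have mono x y : x <= y -> f x <= f y.
  move=> xy; have [|c _ e] := @MVT_segment R f df x y xy (fun t _ => hf t).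
    exact/continuous_subspaceT/derivable_line_continuous.
  by rewrite -subr_ge0 e mulr_ge0 // subr_ge0.
have le x y : f y <= f x.
  pose n := Num.bound ((y - x) / l).
  rewrite -(periodic_mulrz n pf x); apply: mono.
  rewrite -lerBlDl -pmulrn -mulr_natr mulrC -ler_pdivrMr //.
  have [yx|xy] := leP 0 ((y - x) / l); first exact/ltW/archi_boundP.
  exact: (le_trans (ltW xy)).
have fE : f = cst (f 0) by apply/funext => x; apply/le_anti; rewrite !le.
move=> t; have := hf t; rewrite fE => h.
exact: is_derive_unique h (is_derive_cst _ _ _).
Qed.

Lemma periodic_critical_point (f df : R -> R) (l : R) :
  0 < l -> (forall t, f (t + l) = f t) ->
  (forall t : R, is_derive t 1 f (df t)) -> exists t, df t = 0.
Proof.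
move=> l0 pf hf; have [|||t _ h] := @Rolle R f 0 l l0.
- by move=> t _; case: (hf t).
- exact/continuous_subspaceT/derivable_line_continuous.
- by rewrite -[in RHS](add0r l) pf.
- by exists t; apply: is_derive_unique (hf t) h.
Qed.

End Periodic.

(** * Symplectic linear algebra and the Frenet equations *)

Section SymplecticAlgebra.
Context {R : realType}.
Implicit Types (X Y e : 'rV[R]_4) (a : R).

Lemma LambdaDl X Y e : Lambda (X + Y) e = Lambda X e + Lambda Y e.
Proof. by rewrite /Lambda !mxE; ring. Qed.
Lemma LambdaDr X Y e : Lambda e (X + Y) = Lambda e X + Lambda e Y.
Proof. by rewrite /Lambda !mxE; ring. Qed.
Lemma LambdaZl a X Y : Lambda (a *: X) Y = a * Lambda X Y.
Proof. by rewrite /Lambda !mxE; ring. Qed.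
Lemma LambdaZr a X Y : Lambda X (a *: Y) = a * Lambda X Y.
Proof. by rewrite /Lambda !mxE; ring. Qed.
Lemma LambdaNl X Y : Lambda (- X) Y = - Lambda X Y.
Proof. by rewrite /Lambda !mxE; ring. Qed.
Lemma LambdaNr X Y : Lambda X (- Y) = - Lambda X Y.
Proof. by rewrite /Lambda !mxE; ring. Qed.
Lemma Lambda0l X : Lambda 0 X = 0.
Proof. by rewrite /Lambda !mxE; ring. Qed.
Lemma Lambda0r X : Lambda X 0 = 0.
Proof. by rewrite /Lambda !mxE; ring. Qed.
Lemma LambdaC X Y : Lambda X Y = - Lambda Y X.
Proof. by rewrite /Lambda; ring. Qed.
Lemma Lambdaxx X : Lambda X X = 0.
Proof. by rewrite /Lambda; ring. Qed.

Definition LambdaE := (LambdaDl, LambdaDr, LambdaNl, LambdaNr, LambdaZl, LambdaZr,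
  Lambda0l, Lambda0r, Lambdaxx).

Definition symplectic_basis (e1 e2 e3 e4 : 'rV[R]_4) : Prop :=
  (Lambda e1 e3 = 1 /\ Lambda e2 e4 = 1) /\
  [/\ Lambda e1 e2 = 0, Lambda e1 e4 = 0, Lambda e2 e3 = 0 & Lambda e3 e4 = 0].

(** With [d = (e3, e4, -e1, -e2)], the matrix of the pairings of [e] with [d] is
    the identity, and a right inverse of a square matrix is a left inverse. *)
Lemma symplectic_expansion e1 e2 e3 e4 X : symplectic_basis e1 e2 e3 e4 ->
  X = Lambda X e3 *: e1 + Lambda X e4 *: e2 - Lambda X e1 *: e3
      - Lambda X e2 *: e4.
Proof.
move=> [[h13 h24] [h12 h14 h23 h34]].
pose e := [:: e1; e2; e3; e4]; pose d := [:: e3; e4; - e1; - e2].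
pose flat (Y : 'rV[R]_4) := [:: Y 0 2; Y 0 3; - Y 0 0; - Y 0 1].
have ord4 (F : 'I_4 -> R) : \sum_i F i = F 0 + F 1 + F 2 + F 3.
  rewrite !big_ord_recr big_ord0 /= add0r.
  by congr (_ + _ + _ + _); congr F; apply: val_inj.
have LambdaF Y Z : Lambda Y Z = \sum_(k < 4) Y 0 k * (flat Z)`_k.
  by rewrite ord4 /Lambda /=; ring.
pose M : 'M[R]_4 := \matrix_(i, k) (e`_i) 0 k.
pose N : 'M[R]_4 := \matrix_(k, j) (flat d`_j)`_k.
have MN : M *m N = 1%:M.
  apply/matrixP => i j; rewrite !mxE.
  transitivity (Lambda e`_i d`_j).
    by rewrite LambdaF; apply: eq_bigr => k _; rewrite !mxE.
  case: i => [[|[|[|[|i]]]] //= ?]; case: j => [[|[|[|[|j]]]] //= ?];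
    rewrite ?LambdaE ?h13 ?h24 ?h12 ?h14 ?h23 ?h34 ?oppr0 //;
    rewrite LambdaC ?h13 ?h24 ?h12 ?h14 ?h23 ?h34 ?oppr0 ?opprK //.
have XE : X = (X *m N) *m M by rewrite -mulmxA (mulmx1C MN) mulmx1.
have XN j : (X *m N) 0 j = Lambda X d`_j.
  by rewrite LambdaF mxE; apply: eq_bigr => k _; rewrite mxE.
apply/rowP => k; rewrite {1}XE [LHS]mxE ord4 !XN !mxE /= !LambdaE.
by rewrite !mulNr.
Qed.

Lemma symplectic_basis_eq0 e1 e2 e3 e4 X : symplectic_basis e1 e2 e3 e4 ->
  Lambda X e1 = 0 -> Lambda X e2 = 0 -> Lambda X e3 = 0 -> Lambda X e4 = 0 ->
  X = 0.
Proof.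
move=> be X1 X2 X3 X4; rewrite (symplectic_expansion X be) X1 X2 X3 X4.
by rewrite !scale0r !subr0 addr0.
Qed.

Lemma symplectic_basis_coords e1 e2 e3 e4 (a b c d : R) :
  symplectic_basis e1 e2 e3 e4 ->
  let X := a *: e1 + b *: e2 + c *: e3 + d *: e4 in
  [/\ Lambda X e3 = a, Lambda X e4 = b, Lambda X e1 = - c & Lambda X e2 = - d].
Proof.
move=> [[h13 h24] [h12 h14 h23 h34]] X.
rewrite /X !LambdaE (LambdaC e2 e1) (LambdaC e3 e1) (LambdaC e3 e2) (LambdaC e4 e1).
rewrite (LambdaC e4 e2) (LambdaC e4 e3) h13 h24 h12 h14 h23 h34; split; ring.
Qed.

Lemma symplectic_basis_free e1 e2 e3 e4 (a b c d : R) :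
  symplectic_basis e1 e2 e3 e4 ->
  a *: e1 + b *: e2 + c *: e3 + d *: e4 = 0 -> [/\ a = 0, b = 0, c = 0 & d = 0].
Proof.
move=> be X0; have [] := symplectic_basis_coords a b c d be.
rewrite X0 !Lambda0l => <- <- /esym/eqP + /esym/eqP.
by rewrite !oppr_eq0 => /eqP -> /eqP ->.
Qed.

Lemma symplectic_basis_Lambda e1 e2 e3 e4 (a1 a2 a3 a4 b1 b2 b3 b4 : R) :
  symplectic_basis e1 e2 e3 e4 ->
  Lambda (a1 *: e1 + a2 *: e2 + a3 *: e3 + a4 *: e4)
         (b1 *: e1 + b2 *: e2 + b3 *: e3 + b4 *: e4)
  = a1 * b3 + a2 * b4 - a3 * b1 - a4 * b2.
Proof.
move=> [[h13 h24] [h12 h14 h23 h34]].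
rewrite !LambdaE (LambdaC e2 e1) (LambdaC e3 e1) (LambdaC e3 e2) (LambdaC e4 e1).
by rewrite (LambdaC e4 e2) (LambdaC e4 e3) h13 h24 h12 h14 h23 h34; ring.
Qed.

(** The pairings between the first five derivatives of a Lagrangian curve
    parameterized by the symplectic arc-length, with constant curvatures. *)
Definition arclength_products (k3 k4 : R) (g1 g2 g3 g4 g5 : 'rV[R]_4) : Prop :=
  [/\ Lambda g1 g2 = 0, Lambda g1 g3 = 0, Lambda g1 g4 = -1 & Lambda g1 g5 = 0] /\
  [/\ Lambda g2 g3 = 1, Lambda g2 g4 = 0, Lambda g2 g5 = - k3,
      Lambda g3 g4 = k3 & Lambda g3 g5 = 0] /\
  Lambda g4 g5 = k4.

Lemma arclength_symplectic_basis k3 k4 g1 g2 g3 g4 g5 :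
  arclength_products k3 k4 g1 g2 g3 g4 g5 ->
  symplectic_basis g1 g2 (- g4 - k3 *: g2) g3.
Proof.
move=> [[h12 h13 h14 h15] [[h23 h24 h25 h34 h35] h45]].
rewrite /symplectic_basis !LambdaE.
by rewrite (LambdaC g4 g3) h12 h13 h14 h23 h24 h34; do !split; ring.
Qed.

(** Both sides have the same pairings with the symplectic basis. *)
Lemma arclength_fifth_derivative k3 k4 g1 g2 g3 g4 g5 :
  arclength_products k3 k4 g1 g2 g3 g4 g5 ->
  g5 = - k3 *: g3 - (k3 ^+ 2 - k4) *: g1.
Proof.
move=> hp; have := arclength_symplectic_basis hp; move: hp.
move=> [[h12 h13 h14 h15] [[h23 h24 h25 h34 h35] h45]] be.
apply/eqP; rewrite -subr_eq0; apply/eqP.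
apply: (symplectic_basis_eq0 be); rewrite !LambdaE ?(LambdaC g5) ?(LambdaC g3 g2)
  ?(LambdaC g3 g1) ?h12 ?h13 ?h14 ?h15 ?h23 ?h24 ?h25 ?h34 ?h35 ?h45; ring.
Qed.

(** Only the leading term pairs non-trivially with [g1]. *)
Lemma arclength_free_order4 k3 k4 g1 g2 g3 g4 g5 a b d :
  arclength_products k3 k4 g1 g2 g3 g4 g5 ->
  g4 + a *: g3 + b *: g2 + d *: g1 <> 0.
Proof.
move=> [[h12 h13 h14 _] _] /(congr1 (Lambda g1)); rewrite !LambdaE h12 h13 h14.
by rewrite !mulr0 !addr0 => /eqP; rewrite oppr_eq0 oner_eq0.
Qed.

(** Only the leading term pairs non-trivially with [g2]. *)
Lemma arclength_free_order3 k3 k4 g1 g2 g3 g4 g5 b d :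
  arclength_products k3 k4 g1 g2 g3 g4 g5 -> g3 + b *: g2 + d *: g1 <> 0.
Proof.
move=> [[h12 _ _ _] [[h23 _ _ _ _] _]] /(congr1 (Lambda g2)).
rewrite !LambdaE (LambdaC g2 g1) h12 h23 oppr0 !mulr0 !addr0 => /eqP.
by rewrite oner_eq0.
Qed.

End SymplecticAlgebra.

Section Frenet.
Context {R : realType}.
Variables (g : R -> 'rV[R]_4) (k3 k4 : R).
Hypotheses (g_lag : lagrangian_curve g) (g_arc : symplectic_arclength g).
Hypotheses (g_k3 : forall s, kappa3 g s = k3) (g_k4 : forall s, kappa4 g s = k4).

Let sm : smooth_curve g := g_lag.1.
Let c := k3 ^+ 2 - k4.

Lemma Lambda_derive1n_const (m n : nat) (a : R) :
  (forall s, Lambda (derive1n m g s) (derive1n n g s) = a) ->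
  forall s, Lambda (derive1n m g s) (derive1n n.+1 g s)
            = - Lambda (derive1n m.+1 g s) (derive1n n g s).
Proof.
move=> h s.
have := is_derive_Lambda (smooth_is_derive m s sm) (smooth_is_derive n s sm).
rewrite (_ : (fun _ => _) = cst a); last exact/funext.
move=> /is_derive_unique /(_ (is_derive_cst _ _ _)) /eqP.
by rewrite addrC addr_eq0 => /eqP.
Qed.

(** Differentiating a constant pairing of two derivatives yields a pairing of
    higher order; all entries of the Gram matrix follow from the four prescribed ones. *)
Lemma derivatives_Lambda s :
  arclength_products k3 k4 (derive1n 1 g s) (derive1n 2 g s) (derive1n 3 g s)
    (derive1n 4 g s) (derive1n 5 g s).
Proof.
have h12 u : Lambda (derive1n 1 g u) (derive1n 2 g u) = 0 by case: g_lag => _ /(_ u)[].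
have h13 u : Lambda (derive1n 1 g u) (derive1n 3 g u) = 0.
  by rewrite (Lambda_derive1n_const h12) Lambdaxx oppr0.
have h14 u : Lambda (derive1n 1 g u) (derive1n 4 g u) = -1.
  by rewrite (Lambda_derive1n_const h13) g_arc.
have h24 u : Lambda (derive1n 2 g u) (derive1n 4 g u) = 0.
  by rewrite (Lambda_derive1n_const g_arc) Lambdaxx oppr0.
have h15 u : Lambda (derive1n 1 g u) (derive1n 5 g u) = 0.
  by rewrite (Lambda_derive1n_const h14) h24 oppr0.
have h25 u : Lambda (derive1n 2 g u) (derive1n 5 g u) = - k3.
  by rewrite (Lambda_derive1n_const h24); congr (- _); exact: g_k3.
have h35 u : Lambda (derive1n 3 g u) (derive1n 5 g u) = 0.
  by rewrite (Lambda_derive1n_const g_k3) Lambdaxx oppr0.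
have h23 : Lambda (derive1n 2 g s) (derive1n 3 g s) = 1 := g_arc s.
have h34 : Lambda (derive1n 3 g s) (derive1n 4 g s) = k3 := g_k3 s.
have h45 : Lambda (derive1n 4 g s) (derive1n 5 g s) = k4 := g_k4 s.
exact (conj (And4 (h12 s) (h13 s) (h14 s) (h15 s))
        (conj (And5 h23 (h24 s) (h25 s) h34 (h35 s)) h45)).
Qed.

Lemma frenet3E s : frenet3 g s = - derive1n 4 g s - k3 *: derive1n 2 g s.
Proof. by rewrite /frenet3 g_k3. Qed.

Lemma smooth_frenet3 : smooth_curve (frenet3 g).
Proof.
have s2 := @smooth_curveZ R 'rV[R]_4 (- k3) _ (@smooth_curve_derive1n R 'rV[R]_4 g 2 sm).
have s4 := @smooth_curveZ R 'rV[R]_4 (-1) _ (@smooth_curve_derive1n R 'rV[R]_4 g 4 sm).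
have := @smooth_curveD R 'rV[R]_4 _ _ s4 s2; congr smooth_curve; apply/funext => s.
by rewrite frenet3E scaleN1r scaleNr.
Qed.

Lemma frenet_symplectic s :
  symplectic_basis (frenet1 g s) (frenet2 g s) (frenet3 g s) (frenet4 g s).
Proof.
by rewrite frenet3E; exact: arclength_symplectic_basis (derivatives_Lambda s).
Qed.

Lemma frenet_ode s : derive1n 5 g s = - k3 *: derive1n 3 g s - c *: derive1n 1 g s.
Proof. exact: arclength_fifth_derivative (derivatives_Lambda s). Qed.

Lemma is_derive_frenet1 (s : R) : is_derive s 1 (frenet1 g) (frenet2 g s).
Proof. exact: (smooth_is_derive 1 s sm). Qed.

Lemma is_derive_frenet2 (s : R) : is_derive s 1 (frenet2 g) (frenet4 g s).
Proof. exact: (smooth_is_derive 2 s sm). Qed.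

Lemma is_derive_frenet3 (s : R) : is_derive s 1 (frenet3 g) (c *: frenet1 g s).
Proof.
rewrite (_ : frenet3 g = fun u => - derive1n 4 g u - k3 *: derive1n 2 g u); last first.
  by apply/funext => u; rewrite frenet3E.
have h2 := smooth_is_derive 2 s sm; have h4 := smooth_is_derive 4 s sm.
apply: is_derive_eq; rewrite frenet_ode /frenet1.
by rewrite opprB scaleNr opprK addrK.
Qed.

Lemma is_derive_frenet4 (s : R) :
  is_derive s 1 (frenet4 g) (- k3 *: frenet2 g s - frenet3 g s).
Proof.
rewrite frenet3E /frenet2 scaleNr opprB opprK addKr.
exact: (smooth_is_derive 3 s sm).
Qed.

End Frenet.

(** * Positivity of the curvatures of a closed curve *)

Section PeriodicSystems.
Context {R : realType} {n : nat}.
Implicit Types (W V : R -> 'rV[R]_n) (l : R).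

(** The square of each coordinate is nondecreasing. *)
Lemma periodic_exponential_eq0 W (mu l : R) : 0 < l -> 0 < mu ->
  (forall t, W (t + l) = W t) -> (forall t : R, is_derive t 1 W (mu *: W t)) ->
  forall t, W t = 0.
Proof.
move=> l0 mu0 pW dW t; apply/rowP => i; rewrite mxE.
have dw u := is_derive_coord i (dW u).
have dw2 (u : R) : is_derive u 1 (fun v => W v 0 i * W v 0 i)
    (2 * mu * (W u 0 i * W u 0 i)).
  by have := dw u; rewrite mxE => h; apply: is_derive_eq; rewrite /GRing.scale /=; ring.
suff : 2 * mu * (W t 0 i * W t 0 i) = 0.
  by move/eqP; rewrite !mulf_eq0 pnatr_eq0 (gt_eqF mu0) /= orbb => /eqP.
apply: (periodic_monotone_const l0 _ dw2) => u; first by rewrite pW.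
by rewrite -expr2; apply: mulr_ge0; [rewrite mulr_ge0 // ltW|exact: sqr_ge0].
Qed.

(** Here [W'' = p W' - q W] with [p > 0] pumps energy in: each coordinate of
    [W'^2 + q W^2] has derivative [2 p W'^2]. *)
Lemma periodic_oscillator_eq0 W V (p q l : R) : 0 < l -> 0 < p -> 0 < q ->
  (forall t, W (t + l) = W t) -> (forall t, V (t + l) = V t) ->
  (forall t : R, is_derive t 1 W (V t)) ->
  (forall t : R, is_derive t 1 V (p *: V t - q *: W t)) ->
  forall t, W t = 0.
Proof.
move=> l0 p0 q0 pW pV dW dV t; apply/rowP => i; rewrite mxE.
have dw u := is_derive_coord i (dW u).
have dv (u : R) : is_derive u 1 (fun s => V s 0 i) (p * V u 0 i - q * W u 0 i).
  by have := is_derive_coord i (dV u); rewrite !mxE.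
have de (u : R) : is_derive u 1 (fun s => V s 0 i * V s 0 i + q * (W s 0 i * W s 0 i))
    (2 * p * (V u 0 i * V u 0 i)).
  by have := dv u; have := dw u => h1 h2; apply: is_derive_eq;
     rewrite /GRing.scale /=; ring.
have V0 : (fun s => V s 0 i) = cst 0.
  apply/funext => u; suff : 2 * p * (V u 0 i * V u 0 i) = 0.
    by move/eqP; rewrite !mulf_eq0 pnatr_eq0 (gt_eqF p0) /= orbb => /eqP.
  apply: (periodic_monotone_const l0 _ de) => s; first by rewrite pW pV.
  by rewrite -expr2; apply: mulr_ge0; [rewrite mulr_ge0 // ltW|exact: sqr_ge0].
have := dv t; rewrite V0 => /is_derive_unique /(_ (is_derive_cst _ _ _)) /eqP.
have -> : V t 0 i = 0 by exact: (congr1 (fun f => f t) V0).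
by rewrite mulr0 sub0r oppr_eq0 mulf_eq0 (gt_eqF q0) => /eqP.
Qed.

Lemma periodic_constant_velocity_eq0 W (v : 'rV[R]_n) l : 0 < l ->
  (forall t, W (t + l) = W t) -> (forall t : R, is_derive t 1 W v) -> v = 0.
Proof.
move=> l0 pW dW; apply/rowP => i; rewrite mxE.
have [||_ //] := @periodic_critical_point R (fun t => W t 0 i) (fun=> v 0 i) l l0.
  by move=> t; rewrite pW.
by move=> t; exact: is_derive_coord.
Qed.

End PeriodicSystems.

(** The three facts below concern only the derivatives [g1], ..., [g5] of a closed
    curve, so these are kept as independent functions. *)
Section ClosedJet.
Context {R : realType}.
Variables (g1 g2 g3 g4 g5 : R -> 'rV[R]_4) (k3 k4 l : R).
Hypotheses (d1 : forall s : R, is_derive s 1 g1 (g2 s))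
           (d2 : forall s : R, is_derive s 1 g2 (g3 s))
           (d3 : forall s : R, is_derive s 1 g3 (g4 s))
           (d4 : forall s : R, is_derive s 1 g4 (g5 s)).
Hypothesis prods : forall s,
  arclength_products k3 k4 (g1 s) (g2 s) (g3 s) (g4 s) (g5 s).
Hypotheses (l0 : 0 < l)
           (p1 : forall s, g1 (s + l) = g1 s) (p2 : forall s, g2 (s + l) = g2 s)
           (p3 : forall s, g3 (s + l) = g3 s) (p4 : forall s, g4 (s + l) = g4 s).

Let c := k3 ^+ 2 - k4.

(** If [c = 0] then the derivative of [g3 + k3 g1] is constant. *)
Lemma closed_jet_discriminant_neq0 : c <> 0.
Proof.
move=> c0.
have dE (s : R) : is_derive s 1 (fun u => g4 u + k3 *: g2 u) 0.
  have := d4 s; have := d2 s => h2 h4; apply: is_derive_eq.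
  by rewrite (arclength_fifth_derivative (prods s)) -/c c0 scale0r subr0 scaleNr addNr.
have E0 : g4 0 + k3 *: g2 0 = 0.
  apply: (@periodic_constant_velocity_eq0 _ _ (fun s => g3 s + k3 *: g1 s) _ l l0) => s.
    by rewrite p3 p1.
  rewrite (is_derive_row_const dE 0 s).
  by have := d1 s; have := d3 s => h3 h1; exact: is_derive_eq.
apply: (arclength_free_order4 (a := 0) (b := k3) (d := 0) (prods 0)).
by rewrite !scale0r !addr0.
Qed.

(** If [c < 0] then [X^4 + k3 X^2 + c] has a root [mu > 0], and the quotient by
    [X - mu] applied to the velocity satisfies [W' = mu W]. *)
Lemma closed_jet_discriminant_ge0 : 0 <= c.
Proof.
rewrite leNgt; apply/negP => c0.
(* [mu ^+ 2] is the positive root of [X^2 + k3 X + c]. *)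
pose r : R := Num.sqrt (k3 ^+ 2 - 4 * c).
have d0 : 0 < k3 ^+ 2 - 4 * c by have := sqr_ge0 k3; lra.
have r2 : r ^+ 2 = k3 ^+ 2 - 4 * c by rewrite sqr_sqrtr // ltW.
have rk : k3 < r.
  apply: le_lt_trans (ler_norm k3) _; rewrite -sqrtr_sqr ltr_sqrt //; lra.
pose mu : R := Num.sqrt ((r - k3) / 2).
have mu0 : 0 < mu by rewrite sqrtr_gt0; lra.
have mu2 : mu ^+ 2 = (r - k3) / 2 by rewrite sqr_sqrtr //; lra.
have muc : mu ^+ 4 + k3 * mu ^+ 2 = - c.
  transitivity ((r ^+ 2 - k3 ^+ 2) / 4); last by rewrite r2; field.
  have -> : mu ^+ 4 = mu ^+ 2 * mu ^+ 2 by ring.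
  by rewrite mu2; field.
clearbody mu.
pose W (s : R) : 'rV[R]_4 := g4 s + mu *: g3 s + (mu ^+ 2 + k3) *: g2 s + (mu ^+ 3 + k3 * mu) *: g1 s.
suff : W 0 = 0 by rewrite /W; exact: (arclength_free_order4 (prods 0)).
apply: (@periodic_exponential_eq0 R _ W mu l l0 mu0) => s; first by rewrite /W p1 p2 p3 p4.
have := d1 s; have := d2 s; have := d3 s; have := d4 s => h4 h3 h2 h1.
apply: is_derive_eq; rewrite (arclength_fifth_derivative (prods s)) /W -/c -(opprK c) -muc.
by apply/rowP => i; rewrite !mxE; ring.
Qed.

(** If [k3 <= 0 < c], put [q = sqrt c] and [p^2 = 2 q - k3 > 0]; then
    [X^4 + k3 X^2 + c = (X^2 - p X + q) (X^2 + p X + q)], and the second factor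
    applied to the velocity is killed by the first. *)
Lemma closed_jet_curvature_gt0 : 0 < k3.
Proof.
have c0 : 0 < c.
  by rewrite lt0r closed_jet_discriminant_ge0 andbT; apply/eqP/closed_jet_discriminant_neq0.
rewrite ltNge; apply/negP => k30.
pose q : R := Num.sqrt c; have q0 : 0 < q by rewrite sqrtr_gt0.
have q2 : q ^+ 2 = c by rewrite sqr_sqrtr // ltW.
clearbody q.
pose p : R := Num.sqrt (2 * q - k3); have p0 : 0 < p by rewrite sqrtr_gt0; lra.
have pp : p ^+ 2 = 2 * q - k3 by rewrite sqr_sqrtr //; lra.
clearbody p.
pose W (s : R) : 'rV[R]_4 := g3 s + p *: g2 s + q *: g1 s.
pose V (s : R) : 'rV[R]_4 := g4 s + p *: g3 s + q *: g2 s.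
suff : W 0 = 0 by rewrite /W; exact: (arclength_free_order3 (prods 0)).
apply: (@periodic_oscillator_eq0 R _ W V p q l l0 p0 q0) => s.
- by rewrite /W p1 p2 p3.
- by rewrite /V p2 p3 p4.
have := d2 s; have := d3 s; have := d4 s => h4 h3 h2.
apply: is_derive_eq; rewrite (arclength_fifth_derivative (prods s)) /W /V -/c -q2.
have -> : k3 = 2 * q - p ^+ 2 by rewrite pp; ring.
by apply/rowP => i; rewrite !mxE; ring.
Qed.

End ClosedJet.

Section ClosedCurve.
Context {R : realType}.
Variables (g : R -> 'rV[R]_4) (k3 k4 l : R).
Hypotheses (g_lag : lagrangian_curve g) (g_arc : symplectic_arclength g).
Hypotheses (g_k3 : forall s, kappa3 g s = k3) (g_k4 : forall s, kappa4 g s = k4).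
Hypotheses (l0 : 0 < l) (g_per : forall s, g (s + l) = g s).

Let sm : smooth_curve g := g_lag.1.
Let c := k3 ^+ 2 - k4.
Let D m (s : R) : is_derive s 1 (derive1n m g) (derive1n m.+1 g s)
  := smooth_is_derive m s sm.
Let prods s := derivatives_Lambda g_lag g_arc g_k3 g_k4 s.
Let per m s : derive1n m g (s + l) = derive1n m g s := periodic_derive1n g_per m s.

Lemma closed_curve_discriminant_gt0 : 0 < c.
Proof.
rewrite lt0r (closed_jet_discriminant_ge0 (D 1) (D 2) (D 3) (D 4) prods l0
  (per 1) (per 2) (per 3) (per 4)) andbT; apply/eqP.
exact: (closed_jet_discriminant_neq0 (D 1) (D 2) (D 3) (D 4) prods l0
  (per 1) (per 3)).
Qed.

Lemma closed_curve_curvature_gt0 : 0 < k3.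
Proof.
exact: (closed_jet_curvature_gt0 (D 1) (D 2) (D 3) (D 4) prods l0
  (per 1) (per 2) (per 3) (per 4)).
Qed.

(** The derivative of [E3] is [c] times the velocity. *)
Lemma frenet_curve_center :
  exists v : 'rV[R]_4, forall s, g s = c^-1 *: frenet3 g s + v.
Proof.
have h (u : R) : is_derive u 1 (fun s => g s - c^-1 *: frenet3 g s) 0.
  have h3 := is_derive_frenet3 g_lag g_arc g_k3 g_k4 u.
  have h0 : is_derive u 1 g (frenet1 g u) := D 0 u.
  apply: is_derive_eq; rewrite scalerA mulVf ?scale1r ?subrr //.
  by rewrite gt_eqF // closed_curve_discriminant_gt0.
exists (g 0 - c^-1 *: frenet3 g 0) => s.
have move_sub (A B v : 'rV[R]_4) : A - B = v -> A = B + v by move=> <-; rewrite addrC subrK.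
exact: move_sub (is_derive_row_const h s 0).
Qed.

End ClosedCurve.

(** * Curves on a quadric and the rigidity of frame translations *)

Section QuadricCurve.
Context {R : realType}.
Variables (x y z dx dy dz : R -> R) (k3 h l : R).
Hypotheses (hx : forall t : R, is_derive t 1 x (dx t))
           (hy : forall t : R, is_derive t 1 y (dy t))
           (hz : forall t : R, is_derive t 1 z (dz t)).
Hypothesis quadric : forall t, x t ^+ 2 + k3 * y t ^+ 2 - z t ^+ 2 = h.

Lemma quadric_tangent t : x t * dx t + k3 * (y t * dy t) - z t * dz t = 0.
Proof.
have D : is_derive t 1 (fun u => x u * x u + k3 * (y u * y u) - z u * z u)
    (2 * (x t * dx t + k3 * (y t * dy t) - z t * dz t)).
  by have := hx t; have := hy t; have := hz t => h1 h2 h3; apply: is_derive_eq;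
     rewrite /GRing.scale /=; ring.
have E : (fun u => x u * x u + k3 * (y u * y u) - z u * z u) = cst h.
  by apply/funext => u; rewrite -(quadric u) /=; ring.
rewrite E in D; have := is_derive_unique D (is_derive_cst _ _ _).
by move/eqP; rewrite mulf_eq0 pnatr_eq0 => /eqP.
Qed.

Hypotheses (l0 : 0 < l) (k30 : 0 < k3) (z0 : forall t, z t != 0).
Hypotheses (px : forall t, x (t + l) = x t) (py : forall t, y (t + l) = y t)
           (pz : forall t, z (t + l) = z t).
Hypothesis regular : forall t, dx t = 0 -> dy t = 0 -> dz t <> 0.

(** A plane through the origin other than [z = 0] containing the curve.  The
    function [phi] is a coordinate on the line that the plane cuts on the affine
    chart [(x / z, y / z)]; where its derivative vanishes, the velocity is
    radial. *)
Section Planar.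
Variables (n1 n2 n3 : R).
Hypothesis plane : forall t, n1 * x t + n2 * y t + n3 * z t = 0.
Let N := n1 ^+ 2 + n2 ^+ 2.
Hypothesis N0 : 0 < N.

Let phi t := (n1 * y t - n2 * x t) / z t.
Let dphi t := ((n1 * dy t - n2 * dx t) * z t - (n1 * y t - n2 * x t) * dz t) / z t ^+ 2.

Let hphi (t : R) : is_derive t 1 phi (dphi t).
Proof.
have h1 := hx t; have h2 := hy t.
have h3 : is_derive t 1 (fun u => (z u)^-1) (- (z t) ^- 2 *: dz t).
  by have h4 := hz t; apply: is_deriveV; exact: z0.
rewrite /phi; apply: is_derive_eq; rewrite /dphi /GRing.scale /=.
by field; exact: z0.
Qed.

Let plane_tangent t : n1 * dx t + n2 * dy t + n3 * dz t = 0.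
Proof.
have h1 := hx t; have h2 := hy t; have h3 := hz t.
have D : is_derive t 1 (fun u => n1 * x u + n2 * y u + n3 * z u)
    (n1 * dx t + n2 * dy t + n3 * dz t).
  by apply: is_derive_eq; rewrite /GRing.scale /=; ring.
have E : (fun u => n1 * x u + n2 * y u + n3 * z u) = cst 0.
  by apply/funext => u; rewrite plane.
by rewrite E in D; exact: is_derive_unique D (is_derive_cst _ _ _).
Qed.

(** The derivative of [phi] and the tangent plane equation form an orthogonal
    system for the derivatives of [x / z] and [y / z]. *)
Let radial t : dphi t = 0 -> dx t * z t = x t * dz t /\ dy t * z t = y t * dz t.
Proof.
move=> /eqP; rewrite /dphi mulf_eq0 invr_eq0 expf_eq0 (negbTE (z0 t)) orbF => /eqP d0.
have pt := plane_tangent t; have p := plane t.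
have e : n1 * (dx t * z t - x t * dz t) + n2 * (dy t * z t - y t * dz t) = 0.
  transitivity ((n1 * dx t + n2 * dy t + n3 * dz t) * z t
                - (n1 * x t + n2 * y t + n3 * z t) * dz t); first by ring.
  by rewrite pt p; ring.
have ex : N * (dx t * z t - x t * dz t) = 0.
  transitivity (n1 * (n1 * (dx t * z t - x t * dz t) + n2 * (dy t * z t - y t * dz t))
     - n2 * ((n1 * dy t - n2 * dx t) * z t - (n1 * y t - n2 * x t) * dz t)).
    by rewrite /N; ring.
  by rewrite e d0; ring.
have ey : N * (dy t * z t - y t * dz t) = 0.
  transitivity (n2 * (n1 * (dx t * z t - x t * dz t) + n2 * (dy t * z t - y t * dz t))
     + n1 * ((n1 * dy t - n2 * dx t) * z t - (n1 * y t - n2 * x t) * dz t)).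
    by rewrite /N; ring.
  by rewrite e d0; ring.
have Nn0 : N != 0 by rewrite gt_eqF.
split; apply/eqP; rewrite -subr_eq0.
  by move/eqP: ex; rewrite mulf_eq0 (negbTE Nn0).
by move/eqP: ey; rewrite mulf_eq0 (negbTE Nn0).
Qed.

(** A radial velocity with vanishing third coordinate is zero. *)
Let radial_dz t : dphi t = 0 -> dz t <> 0.
Proof.
move=> d0 dz0; have [ex ey] := radial d0; move: ex ey; rewrite dz0 !mulr0.
move=> /eqP + /eqP; rewrite !mulf_eq0 (negbTE (z0 t)) !orbF => /eqP dx0 /eqP dy0.
exact: regular dx0 dy0 dz0.
Qed.

(** On the cone [h = 0], [phi] takes its values in the roots of the quadratic
    polynomial [A X^2 + B X + C], so it is constant. *)
Let planar_cone : h = 0 -> forall t, dphi t = 0.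
Proof.
move=> h0.
pose A := n2 ^+ 2 + k3 * n1 ^+ 2; pose B := 2 * n1 * n2 * n3 * (1 - k3).
pose C := n1 ^+ 2 * n3 ^+ 2 + k3 * n2 ^+ 2 * n3 ^+ 2 - N ^+ 2.
have A0 : A != 0.
  apply/eqP => A0; have e2 := sqr_ge0 n2; have e1 := sqr_ge0 n1.
  have e3 : 0 <= k3 * n1 ^+ 2 by rewrite mulr_ge0 // ltW.
  have : k3 * n1 ^+ 2 = 0 by move: A0; rewrite /A; lra.
  move=> /eqP; rewrite mulf_eq0 (gt_eqF k30) /= => /eqP n10.
  by move: N0 A0; rewrite /N /A n10; lra.
have quad t : A * (phi t * phi t) + B * phi t + C = 0.
  have q := quadric t; have p := plane t.
  have P : n1 * y t - n2 * x t = phi t * z t by rewrite /phi divfK.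
  have n3z : n3 * z t = - (n1 * x t + n2 * y t) by lra.
  have e1 : n1 * (n3 * z t) + n2 * (phi t * z t) = - N * x t.
    by rewrite n3z -P /N; ring.
  have e2 : n1 * (phi t * z t) - n2 * (n3 * z t) = N * y t.
    by rewrite n3z -P /N; ring.
  have e : (A * (phi t * phi t) + B * phi t + C) * z t ^+ 2 = 0.
    transitivity ((n1 * (n3 * z t) + n2 * (phi t * z t)) ^+ 2
      + k3 * (n1 * (phi t * z t) - n2 * (n3 * z t)) ^+ 2 - N ^+ 2 * z t ^+ 2).
      by rewrite /A /B /C; ring.
    rewrite e1 e2; transitivity (N ^+ 2 * (x t ^+ 2 + k3 * y t ^+ 2 - z t ^+ 2)).
      by ring.
    by rewrite q h0 mulr0.
  by move/eqP: e; rewrite mulf_eq0 expf_eq0 (negbTE (z0 t)) orbF => /eqP.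
have slope t : (2 * A * phi t + B) * dphi t = 0.
  have D : is_derive t 1 (fun u => A * (phi u * phi u) + B * phi u + C)
      ((2 * A * phi t + B) * dphi t).
    by have hp := hphi t; apply: is_derive_eq; rewrite /GRing.scale /=; ring.
  have E : (fun u => A * (phi u * phi u) + B * phi u + C) = cst 0.
    by apply/funext => u; rewrite quad.
  by rewrite E in D; exact: is_derive_unique D (is_derive_cst _ _ _).
have disc t : (2 * A * phi t + B) ^+ 2 = B ^+ 2 - 4 * A * C.
  transitivity (4 * A * (A * (phi t * phi t) + B * phi t + C) + (B ^+ 2 - 4 * A * C)).
    by ring.
  by rewrite quad mulr0 add0r.
(* With zero discriminant [phi] is the double root; otherwise [disc] keeps
   [2 A phi + B] away from zero and [slope] gives the claim. *)
have [D0 t|D0 t] := eqVneq (B ^+ 2 - 4 * A * C) 0.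
  have phiE : phi = cst (- B / (2 * A)).
    apply/funext => u; have /eqP := disc u; rewrite D0 expf_eq0 /= => /eqP e.
    have e2 : A * phi u = - B / 2 by lra.
    by apply: (mulfI A0); rewrite e2 /=; field.
  by have := hphi t; rewrite phiE => /is_derive_unique /(_ (is_derive_cst _ _ _)).
have /eqP := slope t; rewrite mulf_eq0 => /orP[/eqP s0|/eqP //].
by move: D0; rewrite -(disc t) s0 expr0n eqxx.
Qed.

(** For [h <> 0], at a critical point of [phi] the velocity is [z' / z] times the
    position, and tangency to the quadric reads [h z' / z = 0].  For [h = 0] the
    velocity is radial everywhere, in particular at a critical point of [z].
    Both contradict regularity. *)
Lemma planar_quadric_curve_absurd : False.
Proof.
have [h0|h0] := eqVneq h 0.
  have [t dz0] := periodic_critical_point l0 pz hz.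
  exact: radial_dz (planar_cone h0 t) dz0.
have [|t d0] := periodic_critical_point l0 _ hphi.
  by move=> t; rewrite /phi px py pz.
have [ex ey] := radial d0; apply: (radial_dz d0).
have e : h * dz t = 0.
  rewrite -(quadric t).
  transitivity (x t * (x t * dz t) + k3 * (y t * (y t * dz t)) - z t * (z t * dz t)).
    by ring.
  rewrite -ex -ey.
  transitivity ((x t * dx t + k3 * (y t * dy t) - z t * dz t) * z t); first by ring.
  by rewrite quadric_tangent mul0r.
by move/eqP: e; rewrite mulf_eq0 (negbTE h0) => /eqP.
Qed.

End Planar.

Lemma quadric_curve_spans (n1 n2 n3 : R) :
  (forall t, n1 * x t + n2 * y t + n3 * z t = 0) -> [/\ n1 = 0, n2 = 0 & n3 = 0].
Proof.
move=> plane; have [N0|] := ltP 0 (n1 ^+ 2 + n2 ^+ 2).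
  by case: (planar_quadric_curve_absurd plane N0).
have := sqr_ge0 n1; have := sqr_ge0 n2 => h1 h2 h12.
have /eqP : n1 ^+ 2 = 0 by lra.
have /eqP : n2 ^+ 2 = 0 by lra.
rewrite !expf_eq0 /= => /eqP n20 /eqP n10; split => //.
have /eqP := plane 0; rewrite n10 n20 !mul0r !add0r mulf_eq0 (negbTE (z0 0)) orbF.
by move/eqP.
Qed.

End QuadricCurve.

Section FrenetRigidity.
Context {R : realType}.
Variables (E1 E2 E3 E4 : R -> 'rV[R]_4) (k3 c : R).
Hypotheses (d1 : forall s : R, is_derive s 1 E1 (E2 s))
           (d2 : forall s : R, is_derive s 1 E2 (E4 s))
           (d3 : forall s : R, is_derive s 1 E3 (c *: E1 s))
           (d4 : forall s : R, is_derive s 1 E4 (- k3 *: E2 s - E3 s)).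
Hypothesis basis : forall s, symplectic_basis (E1 s) (E2 s) (E3 s) (E4 s).
Hypothesis c0 : c != 0.
Variables (x y z : R -> R) (m a b : R).
Hypothesis m0 : m != 0.
Hypothesis spans : forall n1 n2 n3 : R,
  (forall t, n1 * x t + n2 * y t + n3 * z t = 0) -> [/\ n1 = 0, n2 = 0 & n3 = 0].
Hypothesis z_sign : forall t u, 0 < z t * z u.
Hypothesis shift : forall s t,
  x (t + b) *: E2 (s + a) + (m * z (t + b)) *: E3 (s + a) + y (t + b) *: E4 (s + a)
  = x t *: E2 s + (m * z t) *: E3 s + y t *: E4 s.

Let derive_shifted (X Y dX dY : R -> 'rV[R]_4) :
  (forall s : R, is_derive s 1 X (dX s)) -> (forall s : R, is_derive s 1 Y (dY s)) ->
  (forall s, Lambda (X s) (Y (s + a)) = 0) ->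
  forall s, Lambda (dX s) (Y (s + a)) + Lambda (X s) (dY (s + a)) = 0.
Proof.
move=> hX hY h s.
have := is_derive_Lambda (hX s) (is_derive_translate (hY (s + a))).
rewrite (_ : (fun _ => _) = cst 0); last by apply/funext => u; rewrite h.
by move=> /is_derive_unique /(_ (is_derive_cst _ _ _)).
Qed.

(** Pairing the relation [shift] with [E3 s] gives zero on the right; as the
    coefficients span, [E3 s] is orthogonal to the translates of [E2], [E3], [E4].
    Differentiating these three relations determines [E3 s] up to a sign. *)
Lemma frenet_shift_rigid s : E3 (s + a) = E3 s.
Proof.
(* The relation is used at [t - b], so that [t] runs over all parameters. *)
have L3 u : [/\ Lambda (E3 u) (E2 (u + a)) = 0, Lambda (E3 u) (E4 (u + a)) = 0
              & Lambda (E3 u) (E3 (u + a)) = 0].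
  have [_ [_ _ h23 h34]] := basis u.
  have [|e2 e4 e3] := spans (n1 := Lambda (E3 u) (E2 (u + a)))
    (n2 := Lambda (E3 u) (E4 (u + a))) (n3 := m * Lambda (E3 u) (E3 (u + a))).
    move=> t; have := congr1 (Lambda (E3 u)) (shift u (t - b)).
    rewrite subrK !LambdaE (LambdaC (E3 u) (E2 u)) h23 h34 => e.
    by move: e; rewrite oppr0 !mulr0 !addr0 => <-; ring.
  by split=> //; apply/eqP; move/eqP: e3; rewrite mulf_eq0 (negbTE m0).
have L12 u : Lambda (E1 u) (E2 (u + a)) = 0.
  have := derive_shifted d3 d2 (fun v => let: And3 e _ _ := L3 v in e) u.
  have [_ -> _] := L3 u; rewrite addr0 LambdaZl => /eqP.
  by rewrite mulf_eq0 (negbTE c0) => /eqP.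
have L14 u : Lambda (E1 u) (E4 (u + a)) = 0.
  have := derive_shifted d3 d4 (fun v => let: And3 _ e _ := L3 v in e) u.
  have [e2 e4 e3] := L3 u; rewrite !LambdaE e2 e3 mulr0 subr0 addr0 => /eqP.
  by rewrite mulf_eq0 (negbTE c0) => /eqP.
have L13 u : Lambda (E1 u) (E3 (u + a)) = - Lambda (E3 u) (E1 (u + a)).
  have := derive_shifted d3 d3 (fun v => let: And3 _ _ e := L3 v in e) u.
  rewrite !LambdaE -mulrDr => /eqP; rewrite mulf_eq0 (negbTE c0) /= addr_eq0.
  by move/eqP.
have [[h13 _] [h12 h14 _ _]] := basis s.
have E3E : E3 s = Lambda (E1 s) (E3 (s + a)) *: E3 (s + a).
  have [e2 e4 e3] := L3 s.
  rewrite {1}(symplectic_expansion (E3 s) (basis (s + a))) e2 e3 e4 L13.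
  by rewrite !scale0r subr0 !add0r scaleNr.
have sq : Lambda (E1 s) (E3 (s + a)) ^+ 2 = 1.
  by have := h13; rewrite {1}E3E LambdaZr -expr2.
have zE : Lambda (E1 s) (E3 (s + a)) * z (0 + b) = z 0.
  apply: (mulfI m0); have := congr1 (Lambda (E1 s)) (shift s 0).
  rewrite !LambdaE L12 L14 h12 h14 h13 !mulr0 !addr0 !add0r mulr1 => <-; ring.
rewrite [RHS]E3E.
move/eqP: sq; rewrite sqrf_eq1 => /orP[/eqP ->|/eqP e]; first by rewrite scale1r.
have := z_sign 0 (0 + b); rewrite -zE e mulN1r mulNr -expr2 oppr_gt0.
by rewrite ltNge sqr_ge0.
Qed.

End FrenetRigidity.

(** * Smoothness and differential of the pair map *)

Section Tensor.
Context {R : realType} {V : normedModType R}.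

(** The pair map is a sum of such products, a class stable under directional
    derivatives. *)
Definition tensor (a : R -> R) (G : R -> V) (p : R * R) : V := a p.2 *: G p.1.

Lemma scale_is_bilinear : bilinear_for
  (GRing.Scale.Law.clone _ _ *:%R _) (GRing.Scale.Law.clone _ _ *:%R _)
  (@GRing.scale R V).
Proof.
split=> [u' a x y|u a x y] /=.
- by rewrite scalerDl scalerA.
- by rewrite scalerDr !scalerA mulrC.
Qed.

Lemma is_diff_scale (p : R * V) :
  is_diff p (fun q : R * V => q.1 *: q.2) (fun q => p.1 *: q.2 + q.1 *: p.2).
Proof.
pose M := bilinear_isBilinear.Build R R V V _ _ (@GRing.scale R V) scale_is_bilinear.
pose f : {bilinear R -> V -> V} := HB.pack (@GRing.scale R V) M.
have fc : continuous (fun q : R * V => f q.1 q.2) by move=> q; exact: scale_continuous.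
apply: DiffDef; first exact: (differentiable_bilin p fc).
exact: (diff_bilin p fc).
Qed.

Lemma is_diff_line (c : R -> V) (t : R) (dc : V) :
  is_derive t 1 c dc -> is_diff t c (fun h => h *: dc).
Proof.
case=> c1 <-; have dif := (derivable1_diffP c t).1 c1.
by apply: DiffDef => //; rewrite deriv1E // derive1E.
Qed.

End Tensor.

Lemma is_diff_tensor (R : realType) (V : normedModType R) (a : R -> R) (G : R -> V)
  (p : R * R) (da : R) (dG : V) :
  is_derive p.2 1 a da -> is_derive p.1 1 G dG ->
  is_diff p (tensor a G) (fun u => u.1 *: (a p.2 *: dG) + u.2 *: (da *: G p.1)).
Proof.
move=> ha hG; have h1 := is_diff_line ha; have h2 := is_diff_line hG.
have hs := @is_diff_scale R V (a p.2, G p.1).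
have c1f : continuous (fst : R * R -> R) by move=> q; exact: cvg_fst.
have c2f : continuous (snd : R * R -> R) by move=> q; exact: cvg_snd.
have l1 : is_diff p (fst : R * R -> R) fst.
  apply: DiffDef; first exact: (@linear_differentiable R (R * R)%type R fst p c1f).
  by rewrite (@diff_lin R (R * R)%type R fst p c1f).
have l2 : is_diff p (snd : R * R -> R) snd.
  apply: DiffDef; first exact: (@linear_differentiable R (R * R)%type R snd p c2f).
  by rewrite (@diff_lin R (R * R)%type R snd p c2f).
have c1 : is_diff p (a \o snd) ((fun h => h *: da) \o snd).
  exact: is_diff_comp.
have c2 : is_diff p (G \o fst) ((fun h => h *: dG) \o fst).
  exact: is_diff_comp.
have c3 := is_diff_pair c1 c2.
have := is_diff_comp c3 hs.
rewrite (_ : (fun q : R * V => q.1 *: q.2) \o _ = tensor a G) //.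
move=> h; apply: is_diff_eq h _; apply/funext => u /=.
by rewrite !scalerA (mulrC (a p.2)).
Qed.

Section SmoothMaps.
Context {R : realType}.

Lemma Ck_on_subset (V W : normedModType R) k (A B : set V) (f : V -> W) :
  A `<=` B -> Ck_on k B f -> Ck_on k A f.
Proof.
move=> AB; elim: k f => [|k IH] f /=; first by move=> h p /AB/h.
by move=> [df dv]; split=> [p /AB/df //|v]; exact: IH.
Qed.

Lemma Ck_onD (V W : normedModType R) k (f g : V -> W) :
  Ck_on k setT f -> Ck_on k setT g -> Ck_on k setT (fun p => f p + g p).
Proof.
elim: k f g => [|k IH] f g /=.
  by move=> cf cg p _; apply: continuousD; [exact: cf|exact: cg].
move=> [df vf] [dg vg]; split=> [p _|v].
  by apply: differentiableD; [exact: df|exact: dg].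
rewrite (_ : 'D_v _ = fun p => 'D_v f p + 'D_v g p); first exact: IH.
by apply/funext => p; apply: deriveD; apply: diff_derivable; [exact: df|exact: dg].
Qed.

(** A directional derivative of a tensor is a sum of two tensors, so induction on
    the order of differentiability applies. *)
Lemma smooth_tensor (V : normedModType R) (a : R -> R) (G : R -> V) :
  smooth_curve a -> smooth_curve G -> smooth_on setT (tensor a G).
Proof.
move=> + + k; elim: k a G => [|k IH] a G sa sG.
  move=> p _; apply: differentiable_continuous.
  by have [] := is_diff_tensor (smooth_is_derive0 p.2 sa) (smooth_is_derive0 p.1 sG).
have D p := is_diff_tensor (smooth_is_derive0 p.2 sa) (smooth_is_derive0 p.1 sG).
split=> [p _|v]; first by have [] := D p.
rewrite (_ : 'D_v _ = fun p => tensor (fun t => v.1 *: a t) (derive1 G) p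
                      + tensor (fun t => v.2 *: derive1 a t) G p); last first.
  apply/funext => p; have [dif e] := D p; rewrite deriveE // e /tensor.
  by rewrite !scalerA.
have sda := @smooth_curve_derive1 R R a sa.
have sdG := @smooth_curve_derive1 R V G sG.
have c1 := IH _ _ (@smooth_curveZ R R v.1 a sa) sdG.
have c2 := IH _ _ (@smooth_curveZ R R v.2 _ sda) sG.
exact: (Ck_onD c1 c2).
Qed.

End SmoothMaps.

Section Immersion.
Context {R : realType}.
Variables (g E1 E2 E3 E4 : R -> 'rV[R]_4) (x y z dx dy dz : R -> R) (k3 c q : R).
Hypotheses (d0 : forall s : R, is_derive s 1 g (E1 s))
           (d2 : forall s : R, is_derive s 1 E2 (E4 s))
           (d3 : forall s : R, is_derive s 1 E3 (c *: E1 s))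
           (d4 : forall s : R, is_derive s 1 E4 (- k3 *: E2 s - E3 s)).
Hypothesis basis : forall s, symplectic_basis (E1 s) (E2 s) (E3 s) (E4 s).
Hypotheses (q0 : q != 0) (qc : q ^+ 2 = c).
Hypotheses (hx : forall t : R, is_derive t 1 x (dx t))
           (hy : forall t : R, is_derive t 1 y (dy t))
           (hz : forall t : R, is_derive t 1 z (dz t)).
Hypothesis tangent : forall t, x t * dx t + k3 * (y t * dy t) - z t * dz t = 0.
Hypothesis regular : forall t, dx t = 0 -> dy t = 0 -> dz t <> 0.
Hypothesis z0 : forall t, z t != 0.
Hypotheses (sg : smooth_curve g) (sE2 : smooth_curve E2) (sE3 : smooth_curve E3)
  (sE4 : smooth_curve E4) (sx : smooth_curve x) (sy : smooth_curve y)
  (sz : smooth_curve z).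

Definition frenet_sum (p : R * R) : 'rV[R]_4 :=
  g p.1 + x p.2 *: E2 p.1 + (c^-1 * (q * z p.2 - 1)) *: E3 p.1 + y p.2 *: E4 p.1.

Let wz t := c^-1 * (q * z t - 1).
Let c0 : c != 0. Proof. by rewrite -qc expf_eq0. Qed.

Let frenet_sumE : frenet_sum = fun p => tensor (fun=> 1) g p + tensor x E2 p
  + tensor wz E3 p + tensor y E4 p.
Proof. by apply/funext => p; rewrite /frenet_sum /tensor scale1r. Qed.

Let dframe (p u : R * R) : 'rV[R]_4 :=
  (u.1 * (q * z p.2)) *: E1 p.1 + (u.2 * dx p.2 - u.1 * (k3 * y p.2)) *: E2 p.1
  + (u.2 * (q^-1 * dz p.2) - u.1 * y p.2) *: E3 p.1
  + (u.2 * dy p.2 + u.1 * x p.2) *: E4 p.1.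

Let is_derive_wz (t : R) : is_derive t 1 wz (q^-1 * dz t).
Proof.
have h := hz t; rewrite /wz; apply: is_derive_eq; rewrite /GRing.scale /= -qc.
by field.
Qed.

Let smooth_wz : smooth_curve wz.
Proof.
have s1 : smooth_curve (fun t => q *: z t) := @smooth_curveZ R R q z sz.
have s2 := @smooth_curveD R R _ _ s1 (@smooth_curve_cst R R (-1)).
have s3 := @smooth_curveZ R R c^-1 _ s2.
exact: s3.
Qed.

Let diff_frenet_sum p : is_diff p frenet_sum (dframe p).
Proof.
have t0 := is_diff_tensor (is_derive_cst (1 : R) p.2 1) (d0 p.1).
have t2 := is_diff_tensor (hx p.2) (d2 p.1).
have t3 := is_diff_tensor (is_derive_wz p.2) (d3 p.1).
have t4 := is_diff_tensor (hy p.2) (d4 p.1).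
rewrite frenet_sumE; apply: is_diff_eq; apply/funext => u /=.
rewrite /dframe /wz; apply/rowP => i; rewrite !mxE -qc.
by field.
Qed.

(** The coordinate on [E1] of the differential is [u.1 * (q * z)], which detects
    [u.1]; the other three then detect [u.2] by regularity. *)
Lemma lagrangian_immersion_frenet_sum : lagrangian_immersion_on setT frenet_sum.
Proof.
split.
- move=> k; rewrite frenet_sumE.
  have t0 := smooth_tensor (@smooth_curve_cst R R 1) sg k.
  have t2 := smooth_tensor sx sE2 k; have t3 := smooth_tensor smooth_wz sE3 k.
  have t4 := smooth_tensor sy sE4 k.
  exact: (Ck_onD (Ck_onD (Ck_onD t0 t2) t3) t4).
- move=> p _; have [_ dE] := diff_frenet_sum p.
  suff ker u : 'd frenet_sum p u = 0 -> u = 0.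
    move=> u v e; apply/eqP; rewrite -subr_eq0; apply/eqP/ker.
    by rewrite linearB e subrr.
  rewrite dE => /(symplectic_basis_free (basis p.1)) [/eqP].
  rewrite mulf_eq0 mulf_eq0 (negbTE q0) (negbTE (z0 _)) !orbF => /eqP u1.
  rewrite u1 !mul0r !subr0 addr0 => /eqP ex /eqP ez /eqP ey.
  suff u2 : u.2 = 0 by rewrite [u]surjective_pairing u1 u2.
  apply/eqP/negPn/negP => u2; move: ex ez ey.
  rewrite !mulf_eq0 invr_eq0 (negbTE q0) (negbTE u2) /= => /eqP ex /eqP ez /eqP ey.
  exact: regular ex ey ez.
- move=> p _ u v; have [_ ->] := diff_frenet_sum p.
  rewrite /dframe (symplectic_basis_Lambda _ _ _ _ _ _ _ _ (basis p.1)).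
  transitivity ((u.2 * v.1 - u.1 * v.2)
    * (x p.2 * dx p.2 + k3 * (y p.2 * dy p.2) - z p.2 * dz p.2)).
    by field.
  by rewrite tangent mulr0.
Qed.

End Immersion.

(** * Periods of the pair map *)

Section FrenetSumPeriods.
Context {R : realType}.
Variables (g E1 E2 E3 E4 : R -> 'rV[R]_4) (x y z : R -> R) (k3 c q : R) (v : 'rV[R]_4).
Hypotheses (d0 : forall s : R, is_derive s 1 g (E1 s))
           (d1 : forall s : R, is_derive s 1 E1 (E2 s))
           (d2 : forall s : R, is_derive s 1 E2 (E4 s))
           (d3 : forall s : R, is_derive s 1 E3 (c *: E1 s))
           (d4 : forall s : R, is_derive s 1 E4 (- k3 *: E2 s - E3 s)).
Hypothesis basis : forall s, symplectic_basis (E1 s) (E2 s) (E3 s) (E4 s).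
Hypotheses (c0 : c != 0) (q0 : q != 0).
Hypothesis center : forall s, g s = c^-1 *: E3 s + v.
Hypothesis spans : forall n1 n2 n3 : R,
  (forall t, n1 * x t + n2 * y t + n3 * z t = 0) -> [/\ n1 = 0, n2 = 0 & n3 = 0].
Hypothesis z_sign : forall t u, 0 < z t * z u.

(** The rigidity of the frame makes [E3], hence [g] and all its derivatives,
    [a]-periodic; comparing coordinates in one frame leaves the second period. *)
Lemma frenet_sum_period (a b : R) :
  (forall s t, frenet_sum g E2 E3 E4 x y z c q (s + a, t + b)
               = frenet_sum g E2 E3 E4 x y z c q (s, t)) ->
  (forall s, g (s + a) = g s) /\
  (forall t, [/\ x (t + b) = x t, y (t + b) = y t & z (t + b) = z t]).
Proof.
move=> per; pose m := c^-1 * q.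
have m0 : m != 0 by rewrite mulf_neq0 // invr_eq0.
have sumE s t : frenet_sum g E2 E3 E4 x y z c q (s, t)
    = x t *: E2 s + (m * z t) *: E3 s + y t *: E4 s + v.
  by rewrite /frenet_sum /= center; apply/rowP => i; rewrite !mxE /m; ring.
have shift s t :
    x (t + b) *: E2 (s + a) + (m * z (t + b)) *: E3 (s + a) + y (t + b) *: E4 (s + a)
    = x t *: E2 s + (m * z t) *: E3 s + y t *: E4 s.
  by apply: (addIr v); rewrite -!sumE.
have p3 := frenet_shift_rigid d2 d3 d4 basis c0 m0 spans z_sign shift.
have p0 s : g (s + a) = g s by rewrite !center p3.
have p1 := derive_periodic d0 p0; have p2 := derive_periodic d1 p1.
have p4 := derive_periodic d2 p2.
split=> // t.
have [|_ ex ez ey] := symplectic_basis_free (a := 0) (b := x (t + b) - x t)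
  (c := m * z (t + b) - m * z t) (d := y (t + b) - y t) (basis 0).
  have := shift 0 t; rewrite p2 p3 p4 => /eqP; rewrite -subr_eq0 => /eqP e.
  by rewrite -[RHS]e; apply/rowP => i; rewrite !mxE; ring.
split; [exact: subr0_eq|exact: subr0_eq|].
by apply: (mulfI m0); exact: subr0_eq.
Qed.

End FrenetSumPeriods.

(** * The torus *)

Section Torus.
Context {R : realType}.

Lemma pi_torus_eq (v w p q : R * R) :
  \pi_(torus v w) p = \pi_(torus v w) q <-> p - q \in lattice v w.
Proof.
rewrite (_ : (p - q \in lattice v w) = (p == q %[mod torus v w])) //.
  by split=> [/eqP|/eqP].
exact: Quotient.idealrBE.
Qed.

Lemma in_rect_lattice (l1 l2 : R) (p : R * R) :
  p \in lattice (l1, 0) (0, l2) <-> exists m n : int, p = (l1 *~ m, l2 *~ n).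
Proof.
have E (m n : int) : (l1, 0) *~ m + (0, l2) *~ n = (l1 *~ m, l2 *~ n) :> R * R.
  have M1 : ((l1, 0) *~ m : R * R).1 = l1 *~ m by exact: (raddfMz fst).
  have M2 : ((l1, 0) *~ m : R * R).2 = 0 *~ m by exact: (raddfMz snd).
  have N1 : ((0, l2) *~ n : R * R).1 = 0 *~ n by exact: (raddfMz fst).
  have N2 : ((0, l2) *~ n : R * R).2 = l2 *~ n by exact: (raddfMz snd).
  rewrite [LHS]surjective_pairing; congr pair.
    by rewrite [LHS]/= M1 N1 mul0rz addr0.
  by rewrite [LHS]/= M2 N2 mul0rz add0r.
split=> [/asboolP|] [m [n ->]]; first by exists m, n.
by apply/asboolP; exists m, n.
Qed.

Lemma lattice_periodic (T : Type) (f : R * R -> T) (l1 l2 : R) :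
  (forall s t, f (s + l1, t) = f (s, t)) -> (forall s t, f (s, t + l2) = f (s, t)) ->
  forall p q, p \in lattice (l1, 0) (0, l2) -> f (q + p) = f q.
Proof.
move=> f1 f2 p [s t] /in_rect_lattice[m [n ->]].
transitivity (f (s, t + l2 *~ n)).
  by apply: (periodic_mulrz (c := fun u => f (u, t + l2 *~ n))) => u; exact: f1.
by apply: (periodic_mulrz (c := fun u => f (s, u))) => u; exact: f2.
Qed.

Lemma mulrz_small_eq0 (l : R) (m : int) : 0 < l -> `|l *~ m| < l -> m = 0.
Proof.
move=> l0; rewrite -mulrzr normrM gtr0_norm // -[ltRHS]mulr1 ltr_pM2l //.
by rewrite -intr_norm ltrz1 -[1]add0r ltzD1 normr_le0 => /eqP.
Qed.

(** In a ball of radius [r] at most half of both periods, two points that differ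
    by a lattice vector coincide. *)
Lemma torus_lagrangian_immersion_quotient (f : R * R -> 'rV[R]_4) (l1 l2 : R) :
  0 < l1 -> 0 < l2 ->
  (forall p q, p \in lattice (l1, 0) (0, l2) -> f (q + p) = f q) ->
  lagrangian_immersion_on setT f ->
  exists2 ftilde : torus (l1, 0) (0, l2) -> 'rV[R]_4,
    forall p, ftilde (\pi p) = f p & torus_lagrangian_immersion ftilde.
Proof.
move=> l10 l20 fper [fs finj fL]; pose ftilde (Q : torus (l1, 0) (0, l2)) := f (repr Q).
have fE p : ftilde (\pi_(torus (l1, 0) (0, l2)) p) = f p.
  rewrite /ftilde; set r := repr _.
  rewrite -[r](addrNK p) addrC; apply: fper; apply/pi_torus_eq.
  by rewrite reprK.
exists ftilde => // Q; pose p := repr Q; pose r := Num.min l1 l2 / 2.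
have r0 : 0 < r by rewrite divr_gt0 // lt_min l10.
exists (ball p r); split.
- exact: ball_open.
- move=> u v; rewrite !inE => - [u1 u2] [v1 v2] /pi_torus_eq /in_rect_lattice[m [n e]].
  have small (a b x l : R) : r <= l / 2 -> ball x r a -> ball x r b -> `|a - b| < l.
    move=> rl; rewrite -ball_normE /= => h1 h2.
    rewrite (_ : a - b = (x - b) - (x - a)); last by ring.
    by apply: le_lt_trans (ler_normB _ _) _; lra.
  have r1 : r <= l1 / 2 by rewrite ler_pM2r // ge_min lexx.
  have r2 : r <= l2 / 2 by rewrite ler_pM2r // ge_min lexx orbT.
  have e1 : u.1 - v.1 = l1 *~ m := congr1 fst e.
  have e2 : u.2 - v.2 = l2 *~ n := congr1 snd e.
  have m0 : m = 0 by apply: (mulrz_small_eq0 l10); rewrite -e1; exact: small u1 v1.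
  have n0 : n = 0 by apply: (mulrz_small_eq0 l20); rewrite -e2; exact: small u2 v2.
  by apply/eqP; rewrite -subr_eq0 e m0 n0.
- by exists p; [exact: ballxx|rewrite reprK].
rewrite (_ : (fun _ => _) = f); last by apply/funext => u; rewrite fE.
split=> [k|u _|u _]; [exact: Ck_on_subset (fs k)|exact: finj|exact: fL].
Qed.

End Torus.

(** * Conclusion *)

Theorem mainTheorem3 (R : realType) (gamma : R -> 'rV[R]_4) (k3 k4 lgamma : R)
    (gamma_lagrangian : lagrangian_curve gamma)
    (gamma_arclength : symplectic_arclength gamma)
    (gamma_closed : minimal_period gamma lgamma)
    (gamma_k3 : forall s, kappa3 gamma s = k3)
    (gamma_k4 : forall s, kappa4 gamma s = k4)
    (h : R) (alpha : R -> 'rV[R]_3) (lalpha : R)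
    (alpha_closed : closed_arclength_curve alpha lalpha)
    (alpha_quadric :
      (forall t, alpha t 0 0 ^+ 2 + k3 * alpha t 0 1 ^+ 2 - alpha t 0 2 ^+ 2 = h
                 /\ 0 < alpha t 0 2) \/
      (forall t, alpha t 0 0 ^+ 2 + k3 * alpha t 0 1 ^+ 2 - alpha t 0 2 ^+ 2 = h
                 /\ alpha t 0 2 < 0)) :
  let f := curve_pair_map k3 k4 gamma alpha in
  [/\ 0 < k3 /\ 0 < k3 ^+ 2 - k4,
      forall p : R * R,
        (forall q, f (q + p) = f q) <-> p \in lattice (lgamma, 0) (0, lalpha),
      lagrangian_immersion_on setT f &
      exists2 ftilde : torus (lgamma, 0) (0, lalpha) -> 'rV[R]_4,
        forall p, ftilde (\pi p) = f p & torus_lagrangian_immersion ftilde].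
Proof.
move=> f; have [l0 g_per _] := gamma_closed.
have [alpha_smooth alpha_unit alpha_min] := alpha_closed.
have [la0 alpha_per _] := alpha_min.
pose c := k3 ^+ 2 - k4.
have c0 : 0 < c := closed_curve_discriminant_gt0 gamma_lagrangian gamma_arclength
  gamma_k3 gamma_k4 l0 g_per.
have k30 : 0 < k3 := closed_curve_curvature_gt0 gamma_lagrangian gamma_arclength
  gamma_k3 gamma_k4 l0 g_per.
pose q : R := Num.sqrt c.
have q0 : q != 0 by rewrite gt_eqF // sqrtr_gt0.
have qc : q ^+ 2 = c by rewrite sqr_sqrtr // ltW.
pose x t := alpha t 0 0; pose y t := alpha t 0 1; pose z t := alpha t 0 2.
pose dx (t : R) : R := derive1 alpha t 0 0; pose dy (t : R) : R := derive1 alpha t 0 1.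
pose dz (t : R) : R := derive1 alpha t 0 2.
have ha (t : R) := smooth_is_derive0 t alpha_smooth.
have hx (t : R) : is_derive t 1 x (dx t) := is_derive_coord 0 (ha t).
have hy (t : R) : is_derive t 1 y (dy t) := is_derive_coord 1 (ha t).
have hz (t : R) : is_derive t 1 z (dz t) := is_derive_coord 2 (ha t).
have ord3 (F : 'I_3 -> R) : \sum_i F i = F 0 + F 1 + F 2.
  rewrite !big_ord_recr big_ord0 /= add0r.
  by congr (_ + _ + _); congr F; apply: val_inj.
have regular t : dx t = 0 -> dy t = 0 -> dz t <> 0.
  move=> e1 e2 e3; have := alpha_unit t; rewrite /euclidean_norm ord3.
  rewrite -/(dx t) -/(dy t) -/(dz t) e1 e2 e3 expr0n /= !addr0 sqrtr0 => /eqP.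
  by rewrite eq_sym oner_eq0.
have quadric t : x t ^+ 2 + k3 * y t ^+ 2 - z t ^+ 2 = h.
  by case: alpha_quadric => /(_ t)[].
have z_sign t u : 0 < z t * z u.
  case: alpha_quadric => H; have [_ h1] := H t; have [_ h2] := H u.
    exact: mulr_gt0.
  by rewrite nmulr_rgt0.
have z0 t : z t != 0.
  by apply/eqP => e; have := z_sign t t; rewrite e mul0r ltxx.
have tangent := quadric_tangent hx hy hz quadric.
have d0 (s : R) : is_derive s 1 gamma (frenet1 gamma s).
  exact: smooth_is_derive0 s gamma_lagrangian.1.
have d1 := is_derive_frenet1 gamma_lagrangian.
have d2 := is_derive_frenet2 gamma_lagrangian.
have d3 := is_derive_frenet3 gamma_lagrangian gamma_arclength gamma_k3 gamma_k4.
have d4 := is_derive_frenet4 gamma_lagrangian gamma_k3.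
have basis := frenet_symplectic gamma_lagrangian gamma_arclength gamma_k3 gamma_k4.
have [v centerE] := frenet_curve_center gamma_lagrangian gamma_arclength
  gamma_k3 gamma_k4 l0 g_per.
have sg : smooth_curve gamma := gamma_lagrangian.1.
have fE : f = frenet_sum gamma (frenet2 gamma) (frenet3 gamma) (frenet4 gamma)
              x y z c q by apply/funext => -[s t].
have E_per n := periodic_derive1n g_per n.
have f1 s t : f (s + lgamma, t) = f (s, t).
  by rewrite /f /curve_pair_map /frenet2 /frenet3 /frenet4 !gamma_k3 g_per
    (E_per 2) (E_per 3) (E_per 4).
have f2 s t : f (s, t + lalpha) = f (s, t).
  by rewrite /f /curve_pair_map alpha_per.
have f_per := lattice_periodic f1 f2.
have imm : lagrangian_immersion_on setT f.
  have sE2 : smooth_curve (frenet2 gamma) :=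
    @smooth_curve_derive1n R 'rV[R]_4 gamma 2 sg.
  have sE4 : smooth_curve (frenet4 gamma) :=
    @smooth_curve_derive1n R 'rV[R]_4 gamma 3 sg.
  have sE3 : smooth_curve (frenet3 gamma) := smooth_frenet3 gamma_lagrangian gamma_k3.
  have sx : smooth_curve x := @smooth_curve_coord R 3 alpha 0 alpha_smooth.
  have sy : smooth_curve y := @smooth_curve_coord R 3 alpha 1 alpha_smooth.
  have sz : smooth_curve z := @smooth_curve_coord R 3 alpha 2 alpha_smooth.
  rewrite fE; exact: (lagrangian_immersion_frenet_sum d0 d2 d3 d4 basis q0 qc hx hy hz
    tangent regular z0 sg sE2 sE3 sE4 sx sy sz).
split => //; last exact: torus_lagrangian_immersion_quotient.
move=> [a b]; split=> [per|/f_per //].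
have spans := quadric_curve_spans hx hy hz quadric la0 k30 z0
  (fun t => congr1 (fun w : 'rV[R]_3 => w 0 0) (alpha_per t))
  (fun t => congr1 (fun w : 'rV[R]_3 => w 0 1) (alpha_per t))
  (fun t => congr1 (fun w : 'rV[R]_3 => w 0 2) (alpha_per t)) regular.
have [pg pa] : (forall s, gamma (s + a) = gamma s) /\
    (forall t, [/\ x (t + b) = x t, y (t + b) = y t & z (t + b) = z t]).
  apply: (frenet_sum_period d0 d1 d2 d3 d4 basis _ q0 centerE spans z_sign).
    by rewrite gt_eqF.
  by move=> s t; rewrite -fE -(per (s, t)).
have [m am] := minimal_period_multiple gamma_closed pg.
have [|n bn] := @minimal_period_multiple _ _ alpha lalpha b alpha_min.
  move=> t; have [ex ey ez] := pa t; apply/rowP => i.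
  case: i => [[|[|[|i]]] //= lti].
  - by have := ex; rewrite /x (_ : Ordinal lti = 0) //; apply: val_inj.
  - by have := ey; rewrite /y (_ : Ordinal lti = 1) //; apply: val_inj.
  - by have := ez; rewrite /z (_ : Ordinal lti = 2) //; apply: val_inj.
by apply/in_rect_lattice; exists m, n; rewrite am bn.
Qed.
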